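(* The polarized variety $\bigl(T\backslash\!\backslash X(w_{3,7})^{ss}_T(\mathcal{L}(7\omega_3)),\ \tilde{\mathcal{L}}(7\omega_3)\bigr)$ is projectively normal.
   Context: $G=SL(7,\mathbb{C})$, $T$ is the subgroup of diagonal matrices, $B$ the subgroup of upper triangular matrices, and $G_{3,7}$ is the Grassmannian of $3$-dimensional subspaces of $\mathbb{C}^7$. For $w=[w(1)<w(2)<w(3)]$ in $\{1,\dots,7\}$, the Schubert variety $X(w)$ is the closure of the $B$-orbit of $[e_{w(1)}\wedge e_{w(2)}\wedge e_{w(3)}]$. $w_{3,7}=[3,5,7]$; $X(w_{3,7})$ is the unique minimal Schubert variety in $G_{3,7}$ admitting semistable points with respect to $\mathcal{L}(7\omega_3)$. $\mathcal{L}(\omega_3)$ is the pullback of $\mathcal{O}(1)$ under the Plücker embedding with its natural $T$-linearization, $\mathcal{L}(7\omega_3)=\mathcal{L}(\omega_3)^{\otimes7}$. $X(w_{3,7})^{ss}_T(\mathcal{L}(7\omega_3))$ is the set of points at which some $T$-invariant section of a positive power of $\mathcal{L}(7\omega_3)$ does not vanish, and the GIT quotient is $\mathrm{Proj}\bigoplus_{m\ge0}R(m)$ with $R(m)=H^0(X(w_{3,7}),\mathcal{L}(7\omega_3)^{\otimes m})^T$. The line bundle $\mathcal{L}(7\omega_3)$ descends to a line bundle $\tilde{\mathcal{L}}(7\omega_3)$ on the GIT quotient, whose $m$-th power has space of global sections $R(m)$. A polarized variety $(Y,\mathcal{M})$ is projectively normal if the ring $\bigoplus_{m\ge0}H^0(Y,\mathcal{M}^{\otimes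 m})$ is normal and generated in degree $1$ (over $\mathbb{C}$); equivalently $Y$ is normal and $H^0(Y,\mathcal{M})^{\otimes m}\to H^0(Y,\mathcal{M}^{\otimes m})$ is surjective for all $m\ge1$. *)

(* Defs.v *)
From mathcomp Require Import all_boot all_order all_algebra.
From mathcomp Require Import classical_sets functions reals.
From mathcomp Require Import complex mpoly.

Set Implicit Arguments.
Unset Strict Implicit.
Unset Printing Implicit Defensive.

Import GRing.Theory.
Local Open Scope classical_set_scope.
Local Open Scope ring_scope.

(* The r-element subsets of {0, ..., n-1}, as increasing maps; they index the
   basis e_{w(1)} /\ ... /\ e_{w(r)} of the r-th exterior power of K^n. *)
Definition increasing (r n : nat) (f : {ffun 'I_r -> 'I_n}) : bool :=
  [forall i : 'I_r, forall j : 'I_r, (i < j)%N ==> (f i < f j)%N].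

Definition plindex (r n : nat) : finType :=
  {f : {ffun 'I_r -> 'I_n} | increasing f}.

Notation pldim r n := #|{: plindex r n}|.

Section Schubert.
Variables (K : fieldType) (r n : nat).

Definition wedge_basis (w : plindex r n) : 'cV[K]_(pldim r n) :=
  delta_mx (enum_rank w) 0.

(* The action of g on the r-th exterior power, in the basis above:
   g . e_J is the sum over I of the minor det(g_{I,J}) times e_I. *)
Definition wedge (g : 'M[K]_n) : 'M[K]_(pldim r n) :=
  let pl (i : 'I_(pldim r n)) : plindex r n := enum_val i in
  \matrix_(i, j) \det (mxsub (val (pl i)) (val (pl j)) g).

(* [is_trig_mx] means lower triangular. *)
Definition borel : set 'M[K]_n := [set b | is_trig_mx b^T /\ \det b = 1].

Definition torus : set 'M[K]_n := [set t | is_diag_mx t /\ \det t = 1].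

(* Subsets of projective space are represented by the nonzero vectors lying
   over them.  Below is the Zariski closure of the B-orbit of [e_w] in the
   projective space of the exterior power; as the Grassmannian is closed
   there, it is also the closure in the Grassmannian. *)
Definition schubert (w : plindex r n) : set 'cV[K]_(pldim r n) :=
  [set x | x != 0 /\
    forall (d : nat) (p : {mpoly K[pldim r n]}), p \is d.-homog ->
      (forall b, borel b ->
         p.@[fun i => (wedge b *m wedge_basis w) i 0] = 0) ->
      p.@[fun i => x i 0] = 0].

(* The global sections of O(d) on a subvariety X of projective space: functions
   on the punctured cone over X that are, locally for the Zariski topology,
   quotients of homogeneous polynomials of degrees d + e and e.  In particular
   s (c *: x) = c ^+ d * s x. *)
Definition global_section (X : set 'cV[K]_(pldim r n)) (d : nat) :
    set (X -> K) :=
  [set s | forall x : X, exists (e : nat) (f g : {mpoly K[pldim r n]}),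
    [/\ f \is (d + e)%N.-homog, g \is e.-homog,
        g.@[fun i => val x i 0] != 0 &
        forall y : X, g.@[fun i => val y i 0] != 0 ->
          s y = f.@[fun i => val y i 0] / g.@[fun i => val y i 0]]].

(* The linearization of O(1) dual to the action on the exterior power makes
   g act on sections by (g . s)(x) = s (g^-1 x). *)
Definition torus_invariant (X : set 'cV[K]_(pldim r n)) : set (X -> K) :=
  [set s | forall t, torus t ->
    forall x y : X, val y = wedge t *m val x -> s y = s x].

(* R(m), the T-invariant sections of L(k omega_r)^m on X(w), where
   L(k omega_r) is the restriction of O(k).  These are the global sections of
   the m-th power of the descended bundle on the GIT quotient, which is the
   Proj of the direct sum of the R(m). *)
Definition quotient_section (w : plindex r n) (k m : nat) :
    set (schubert w -> K) :=
  @global_section (schubert w) (k * m) `&` @torus_invariant (schubert w).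

End Schubert.

(* Normality of a subring S of A: S is an integral domain, and every fraction
   a / b that is a root of a monic polynomial over S belongs to S.  The equation
   is the integrality equation for a / b multiplied by b ^+ n. *)
Definition normal_subring (A : comPzRingType) (S : set A) : Prop :=
  [/\ (1 : A) != 0,
      forall a b, S a -> S b -> a * b = 0 -> a = 0 \/ b = 0 &
      forall a b, S a -> S b -> b != 0 ->
        forall (n : nat) (c : 'I_n -> A), (forall i, S (c i)) ->
          a ^+ n + \sum_(i < n) c i * a ^+ i * b ^+ (n - i) = 0 ->
        exists2 q, S q & a = q * b].

Section ProjectiveNormality.
Variables (K : fieldType) (X : Type) (H : nat -> set (X -> K)).

(* The direct sum of the H m, inside the ring of all functions on X.  When X is
   a punctured cone over an infinite field and the elements of H m are
   homogeneous of pairwise distinct degrees, this sum is direct. *)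
Definition section_ring : set (X -> K) :=
  [set F | exists (n : nat) (s : nat -> X -> K),
    (forall m, H m (s m)) /\ F = \sum_(m < n) s m].

Definition generated_in_degree_one : Prop :=
  forall F, section_ring F ->
    exists (k : nat) (g : 'I_k -> X -> K) (p : {mpoly K[k]}),
      (forall i, H 1 (g i)) /\ forall x, F x = p.@[fun i => g i x].

Definition projectively_normal : Prop :=
  normal_subring section_ring /\ generated_in_degree_one.

End ProjectiveNormality.

Fact w37_subproof :
  increasing [ffun i : 'I_3 => inord (2 * i + 2) : 'I_7].
Proof.
apply/forallP => i; apply/forallP => j; apply/implyP => ltij.
have bnd (l : 'I_3) : (2 * l + 2 < 7)%N by case: l => [[|[|[|]]]].
by rewrite !ffunE !inordK // ltn_add2r ltn_mul2l.
Qed.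

(* [3, 5, 7], which is (2, 4, 6) with indices counted from 0. *)
Definition w37 : plindex 3 7 := Sub _ w37_subproof.

(* Main.v *)
Require Import Defs.
From mathcomp Require Import all_boot all_order all_algebra.
From mathcomp Require Import classical_sets functions reals.
From mathcomp Require Import complex mpoly.
From mathcomp Require Import boolp ring zify.

(** The Borel orbit that is dense in X(3,5,7) consists of 3-planes spanned by
    columns supported in the rows 1-3, 1-5 and 1-7.  The torus and the column
    operations move a general one into the five-dimensional slice of the
    3-planes spanned by

      (1, 1, 1, 0, 0, 0, 0), (x0, x1, 0, 1, 1, 0, 0), (x2, x3, 0, x4, 0, 1, 1),

    so a T-invariant section is determined by its restriction to the slice
    ([eq_section_slice]).  This restriction is a function f on the affine space
    of dimension 5, given locally by quotients of polynomials.  The part of the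
    torus that preserves the slice makes f bihomogeneous
    ([section_slice_rescale]), and it contains a one-parameter group that
    contracts the slice to the origin.  A function that is regular at the origin
    and homogeneous for a contracting action is a polynomial
    ([contracting_regular_mpoly]), so f is a combination of monomials in x0, ...,
    x4 of a prescribed bidegree ([section_slice_mpoly]).

    The monomials allowed in R(1) are x4 x0^2, x4 x0 x1, x4 x1^2, x2 x0, x2 x1,
    x3 x0 and x3 x1, and each one allowed in R(m) is a product of m of them
    ([slice_monomial]).  Each of the seven does come from a section: up to sign,
    it is the restriction of a T-invariant monomial of degree 7 in the Plucker
    coordinates ([gen_slice], [gen_torus]).  Hence the ring of sections is
    generated by these seven elements of R(1) ([section_ringP]), which is
    generation in degree 1.

    Restriction to the slice identifies the ring of sections with the ring of
    polynomials in x0, ..., x4 that are invariant under the multiplicative group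
    acting with weights 1, 1, -1, -1, -2; it is the coordinate ring of the
    rational normal scroll S(1,1,2) in the projective space of dimension 6.  It
    is normal because the polynomial ring is ([mpoly_normal]) and because a
    polynomial that is a quotient of two invariants is an invariant
    ([slice_quotient_gens]). *)

Set Implicit Arguments.
Unset Strict Implicit.
Unset Printing Implicit Defensive.

Import Order.TTheory GRing.Theory Num.Theory.
Local Open Scope ring_scope.

(** * Polynomials as functions *)

Lemma poly_eq0_fun (K : numFieldType) (p : {poly K}) :
  (forall x, p.[x] = 0) -> p = 0.
Proof.
move=> p0; apply/eqP/negPn/negP => pn0.
have rp : all (root p) [seq i%:R | i <- iota 0 (size p)].
  by apply/allP => x _; apply/rootP.
have ui : uniq [seq (i%:R : K) | i <- iota 0 (size p)].
  rewrite map_inj_in_uniq ?iota_uniq // => i j _ _ /eqP.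
  by rewrite eqr_nat => /eqP.
by have := max_poly_roots pn0 rp ui; rewrite size_map size_iota ltnn.
Qed.

Lemma meval_muni (K : comNzRingType) n (p : {mpoly K[n.+1]}) (v : 'I_n.+1 -> K) :
  p.@[v] = (map_poly (meval (fun i : 'I_n => v (widen_ord (leqnSn n) i)))
                     (muni p)).[v ord_max].
Proof.
rewrite mevalE muniE rmorph_sum horner_sum; apply: eq_bigr => m _ /=.
rewrite -!mul_polyC !rmorphM /= map_polyXn !map_polyC /= !hornerE.
rewrite mevalZ mevalX big_ord_recr /= mulrA; congr (_ * _ * _).
by apply: eq_bigr => i _; rewrite mnmE.
Qed.

(** Distinct monomials go to distinct pairs of a monomial in the first [n]
    variables and a power of the last one. *)
Lemma muni_eq0 (K : comNzRingType) n (p : {mpoly K[n.+1]}) :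
  muni p = 0 -> p = 0.
Proof.
move=> p0; apply/mpolyP => m; rewrite mcoeff0.
have [|] := boolP (m \in msupp p); last by move/memN_msupp_eq0.
move=> mp.
pose m0 := [multinom m (widen_ord (leqnSn n) i) | i < n].
have := congr1 (fun q : {poly {mpoly K[n]}} => (q`_(m ord_max))@_m0) p0.
rewrite coef0 mcoeff0 muniE coef_sum raddf_sum /= (bigD1_seq m) ?msupp_uniq //=.
rewrite coefZ coefXn eqxx mulr1 mcoeffZ mcoeffX eqxx mulr1 big1 ?addr0 // => m' m'm.
rewrite coefZ coefXn; case: eqP => [e|]; last by rewrite mulr0 mcoeff0.
rewrite mulr1 mcoeffZ mcoeffX; case: eqP => [e'|]; last by rewrite mulr0.
case/eqP: m'm; apply/mnmP => i.
have [[j ->]|->] : (exists j, i = widen_ord (leqnSn n) j) \/ i = ord_max.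
  have [/eqP|] := boolP (i == ord_max); first by right.
  move=> ni; left; have lt : (i < n)%N.
    by have := ltn_ord i; rewrite ltnS leq_eqVlt => /orP[/eqP e2|//];
      case/eqP: ni; apply: val_inj.
  by exists (Ordinal lt); apply: val_inj.
- by have := congr1 (fun m : 'X_{1..n} => m j) e'; rewrite !mnmE.
- by rewrite e.
Qed.

(** Induction on the number of variables: for fixed values of the first [n]
    variables, the univariate polynomial in the last one has too many roots. *)
Lemma mpoly_eq0_fun (K : numFieldType) n (p : {mpoly K[n]}) :
  (forall v, p.@[v] = 0) -> p = 0.
Proof.
elim: n p => [|n IH] p p0.
  apply/mpolyP => m; rewrite mcoeff0.
  have e (m' : 'X_{1..0}) : m' = m by apply/mnmP => -[].
  have := p0 (fun=> 0); rewrite mevalE.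
  have [mp|] := boolP (m \in msupp p); last by move/memN_msupp_eq0.
  rewrite (bigD1_seq m) ?msupp_uniq //= big_ord0 mulr1 big1 ?addr0 // => m' /eqP[].
  exact: e.
apply: muni_eq0; apply/polyP => k; rewrite coef0; apply: IH => v.
pose q := map_poly (meval v) (muni p).
suff q0 : q = 0 by rewrite -coef_map -/q q0 coef0.
apply: poly_eq0_fun => x.
pose u (i : 'I_n.+1) := if unlift ord_max i is Some j then v j else x.
have := p0 u; rewrite meval_muni {2}/u unlift_none => <-; congr _.[_].
apply/polyP => i; rewrite !coef_map; apply: meval_eq => j /=.
rewrite /u; have -> : widen_ord (leqnSn n) j = lift ord_max j.
  by apply: val_inj; rewrite [RHS]lift_max.
by rewrite liftK.
Qed.

Lemma mpoly_fun_inj (K : numFieldType) n (p q : {mpoly K[n]}) :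
  (forall v, p.@[v] = q.@[v]) -> p = q.
Proof.
move=> e; apply/eqP; rewrite -subr_eq0; apply/eqP/mpoly_eq0_fun => v.
by rewrite mevalB e subrr.
Qed.

(** Nonempty Zariski open subsets of affine space are dense. *)
Lemma mpoly_eq0_dense (K : numFieldType) n (p h : {mpoly K[n]}) : h != 0 ->
  (forall v, h.@[v] != 0 -> p.@[v] = 0) -> p = 0.
Proof.
move=> hn0 ph; apply/eqP; have : p * h == 0.
  apply/eqP/mpoly_eq0_fun => v; rewrite mevalM.
  by have [->|/ph ->] := eqVneq h.@[v] 0; rewrite ?mulr0 ?mul0r.
by rewrite mulf_eq0 (negPf hn0) orbF.
Qed.

(** How the torus weights of a function are read off the monomials of a
    polynomial that represents it. *)
Lemma mpoly_rescale_supp (K : numFieldType) n (p : {mpoly K[n]})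
    (c : 'I_n -> K) k :
  (forall v, p.@[fun i => c i * v i] = k * p.@[v]) ->
  forall m, m \in msupp p -> \prod_i c i ^+ m i = k.
Proof.
move=> e m mp.
pose q := \sum_(m <- msupp p) (p@_m * \prod_i c i ^+ m i) *: 'X_[m].
have : q = k *: p.
  apply: mpoly_fun_inj => v; rewrite mevalZ -e [RHS]mevalE raddf_sum /=.
  apply: eq_bigr => m' _; rewrite mevalZ mevalX -mulrA -big_split /=.
  by congr (_ * _); apply: eq_bigr => i _; rewrite exprMn.
move/(congr1 (mcoeff m)); rewrite mcoeffZ raddf_sum /= (bigD1_seq m) ?msupp_uniq //=.
rewrite mcoeffZ mcoeffX eqxx mulr1 [X in _ + X]big1 ?addr0; last first.
  by move=> m' /negPf m'm; rewrite mcoeffZ mcoeffX m'm mulr0.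
rewrite mulrC => /mulIf; apply; by rewrite -mcoeff_msupp.
Qed.

(** A multiplicative group that acts on affine space with positive weights
    contracts every point [v] to the origin.  Let [f] have weight [k] and let
    [f = F / G] near the origin.  Along the orbit of [v] this reads
    [c^k f(v) G(c v) = F(c v)], an identity of polynomials in [c]; its
    coefficient of degree [k] expresses [f(v)] as [1 / G(0)] times the part of
    [F] of weight [k]. *)
Lemma contracting_regular_mpoly (K : numFieldType) n (w : 'I_n -> nat) k
    (f : ('I_n -> K) -> K) (F G : {mpoly K[n]}) :
    (forall i, 0 < w i)%N ->
    (forall c v, c != 0 -> f (fun i => c ^+ w i * v i) = c ^+ k * f v) ->
    G.@[fun=> 0] != 0 ->
    (forall v, G.@[v] != 0 -> f v = F.@[v] / G.@[v]) ->
  exists P : {mpoly K[n]}, forall v, f v = P.@[v].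
Proof.
move=> w_gt0 fw G0 fFG.
pose wt (m : 'X_{1..n}) := (\sum_i w i * m i)%N.
pose curve v (p : {mpoly K[n]}) : {poly K} :=
  \sum_(m <- msupp p) (p@_m * \prod_i v i ^+ m i) *: 'X^(wt m).
have curveE v p c : (curve v p).[c] = p.@[fun i => c ^+ w i * v i].
  rewrite mevalE horner_sum; apply: eq_bigr => m _.
  rewrite hornerZ hornerXn -mulrA -prodrXr -big_split /=; congr (_ * _).
  by apply: eq_bigr => i _; rewrite exprMn -exprM mulrC.
exists ((G.@[fun=> 0])^-1 *:
  \sum_(m <- msupp F) (F@_m * (k == wt m)%:R) *: 'X_[m]) => v.
have curveG0 : (curve v G).[0] = G.@[fun=> 0].
  rewrite curveE; apply: meval_eq => i.
  by rewrite expr0n eqn0Ngt w_gt0 mul0r.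
have curveGn0 : curve v G != 0.
  by apply: contraNneq G0 => e; rewrite -curveG0 e horner0.
have : curve v F = f v *: ('X^k * curve v G).
  apply/eqP; rewrite -subr_eq0; apply/eqP.
  have : (curve v F - f v *: ('X^k * curve v G)) * ('X * curve v G) == 0.
    apply/eqP/poly_eq0_fun => c.
    rewrite hornerM hornerD hornerN hornerZ !hornerM hornerXn hornerX.
    have [->|cn0] := eqVneq c 0; first by rewrite mul0r mulr0.
    have [->|Gn0] := eqVneq (curve v G).[c] 0; first by rewrite !mulr0.
    rewrite curveE in Gn0; have := fFG _ Gn0; rewrite fw // -!curveE => e.
    rewrite [f v * _]mulrCA [c ^+ k * _]mulrA e divfK ?subrr ?mul0r //.
    by rewrite curveE.
  by rewrite !mulf_eq0 polyX_eq0 (negPf curveGn0) !orbF => /eqP.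
move/(congr1 (fun p : {poly K} => p`_k)); rewrite coefZ coefXnM ltnn subnn.
rewrite -horner_coef0 curveG0 mevalZ => e.
apply: (mulIf G0); rewrite -e mulrAC mulVf // mul1r coef_sum raddf_sum /=.
apply: eq_bigr => m _; rewrite coefZ coefXn mevalZ mevalX mulrAC; exact: erefl.
Qed.

(** * Normality of polynomial rings *)

(** In the next lemma this compares exponents of one variable: [d + k a >= k b]
    with [k > d] forces [a >= b]. *)
Lemma leq_of_scaled_eq (d a q b : nat) :
  (d + a * d.+1 = q + b * d.+1 -> b <= a)%N.
Proof.
move=> e; rewrite leqNgt; apply/negP => lt.
by have := leq_mul lt (leqnn d.+1); rewrite mulSn; lia.
Qed.

(** Complete integral closedness, stated with divisibility instead of
    fractions.  Comparing the leading monomials of [d a^k] and [q b^k] for one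
    large [k] shows that the leading monomial of [b] divides that of [a].
    Subtracting from [a] the multiple of [b] with the same leading term keeps
    the hypothesis, by the binomial formula, and lowers the leading monomial,
    so the division terminates with remainder 0. *)
Lemma mpoly_completely_integrally_closed (K : fieldType) n (a b d : {mpoly K[n]}) :
  b != 0 -> d != 0 -> (forall k, exists q, d * a ^+ k = q * b ^+ k) ->
  exists q, a = q * b.
Proof.
move=> bn0 dn0; elim/mleadrect: a => a IH ab.
have [->|an0] := eqVneq a 0; first by exists 0; rewrite mul0r.
have lmba : (mlead b <= mlead a)%MM.
  apply/mnm_lepP => i; have [q e] := ab (mlead d i).+1.
  have qn0 : q != 0.
    apply: contraTneq isT => q0; have : d * a ^+ (mlead d i).+1 != 0.
      by rewrite mulf_neq0 ?expf_neq0.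
    by rewrite e q0 mul0r eqxx.
  move/(congr1 (@mlead _ _))/(congr1 (fun m : 'X_{1..n} => m i)): e.
  rewrite (mleadM dn0 (expf_neq0 _ an0)) (mleadM qn0 (expf_neq0 _ bn0)).
  rewrite (mleadX _ an0) (mleadX _ bn0) !mnmDE !mulmnE.
  exact: leq_of_scaled_eq.
pose c := mleadc a / mleadc b.
pose q0 := c *: 'X_[mlead a - mlead b] : {mpoly K[n]}.
have [q1 e1] : exists q, a - q0 * b = q * b.
  have [->|a'n0] := eqVneq (a - q0 * b) 0; first by exists 0; rewrite mul0r.
  have cn0 : c != 0 by rewrite mulf_neq0 ?invr_eq0 ?mleadc_eq0.
  have q0n0 : q0 != 0 by rewrite scaler_eq0 (negPf cn0) -msupp_eq0 msuppX.
  have lq : mlead (q0 * b) = mlead a.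
    by rewrite mleadM // mleadZ // mleadXm submK.
  have lcq : mleadc (q0 * b) = mleadc a.
    rewrite mleadM // mleadcM mleadcZE mleadXm mcoeffX eqxx mulr1 divfK //.
    by rewrite mleadc_eq0.
  apply: IH.
    rewrite lt_neqAle; apply/andP; split.
      apply: contraNneq a'n0 => e; rewrite -mleadc_eq0 e mcoeffB.
      by rewrite -lcq lq subrr.
    by apply: le_trans (mleadB_le _ _) _; rewrite lq joinxx.
  move=> k.
  rewrite exprBn mulr_sumr.
  apply: (big_ind (fun p => exists q, p = q * b ^+ k)); first by exists 0; rewrite mul0r.
    by move=> x y [q ->] [q' ->]; exists (q + q'); rewrite mulrDl.
  move=> i _; have [q e] := ab (k - i)%N.
  exists ((-1) ^+ i * q * q0 ^+ i *+ 'C(k, i)).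
  rewrite mulrnAr mulrnAl; congr (_ *+ _).
  have -> : b ^+ k = b ^+ (k - i) * b ^+ i.
    by rewrite -exprD subnK // -ltnS.
  rewrite exprMn.
  transitivity ((-1) ^+ i * (d * a ^+ (k - i)) * q0 ^+ i * b ^+ i); last by rewrite e; ring.
  by ring.
by exists (q1 + q0); rewrite mulrDl -e1 subrK.
Qed.

(** An integral fraction [a / b] is almost integral: the equation of degree [k]
    lets [b^k] clear the denominators of all powers of [a / b]. *)
Lemma mpoly_normal (K : fieldType) n (a b : {mpoly K[n]}) k
    (c : 'I_k -> {mpoly K[n]}) : b != 0 ->
  a ^+ k + \sum_(i < k) c i * a ^+ i * b ^+ (k - i) = 0 ->
  exists q, a = q * b.
Proof.
move=> bn0 e; apply: (@mpoly_completely_integrally_closed _ _ _ _ (b ^+ k)) => //.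
  exact: expf_neq0.
elim/ltn_ind => j IH; case: (leqP j k) => jk.
  by exists (b ^+ (k - j) * a ^+ j); rewrite -{1}(subnK jk) exprD; ring.
have -> : a ^+ j = a ^+ (j - k) * a ^+ k by rewrite -exprD subnK // ltnW.
move/eqP: e; rewrite addr_eq0 => /eqP ->.
rewrite -sumrN mulr_sumr mulr_sumr.
apply: (big_ind (fun p => exists q, p = q * b ^+ j)); first by exists 0; rewrite mul0r.
  by move=> x y [q ->] [q' ->]; exists (q + q'); rewrite mulrDl.
move=> i _; have lti : (j - k + i < j)%N by have := ltn_ord i; lia.
have [q eq] := IH _ lti; exists (- c i * q).
have -> : b ^+ j = b ^+ (j - k + i) * b ^+ (k - i).
  by rewrite -exprD; congr (_ ^+ _); have := ltn_ord i; lia.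
transitivity (- c i * (b ^+ k * a ^+ (j - k + i)) * b ^+ (k - i)); last by rewrite eq; ring.
by rewrite [a ^+ (j - k + i)]exprD; ring.
Qed.

(** * Plucker coordinates *)

Section Plucker.
Variables (r n : nat).

(** The vector of Plucker coordinates of the column space of [A]. *)
Definition plucker (R : comNzRingType) (A : 'M[R]_(n, r)) : 'cV[R]_(pldim r n) :=
  \col_i \det (rowsub (val (enum_val i : plindex r n)) A).

Lemma pluckerM (R : comNzRingType) (A : 'M[R]_(n, r)) (U : 'M[R]_r) :
  plucker (A *m U) = \det U *: plucker A.
Proof.
by apply/colP => i; rewrite !mxE -mul_rowsub_mx det_mulmx mulrC.
Qed.

Lemma map_plucker (R S : comNzRingType) (f : {rmorphism R -> S})
    (A : 'M[R]_(n, r)) : plucker (map_mx f A) = map_mx f (plucker A).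
Proof.
apply/colP => i; rewrite !mxE -det_map_mx; congr (\det _).
by apply/matrixP => j k; rewrite !mxE.
Qed.

Lemma plindex_ltn (f : plindex r n) (i j : 'I_r) :
  (i < j)%N -> (val f i < val f j)%N.
Proof.
by move=> ij; have := valP f => /forallP/(_ i)/forallP/(_ j)/implyP/(_ ij).
Qed.

Lemma plindex_codom_inj (f g : plindex r n) :
  (forall i, val f i \in codom (val g)) -> f = g.
Proof.
have sorted_plindex (h : plindex r n) : sorted ltn (map val (codom (val h))).
  rewrite -map_comp.
  have : sorted ltn (map val (enum 'I_r)) by rewrite val_enum_ord iota_ltn_sorted.
  rewrite !sorted_map; apply: sub_sorted => i j /=; exact: plindex_ltn.
move=> fg; apply/val_inj/ffunP => i.
suff e : codom (val f) = codom (val g).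
  have := congr1 (fun s => nth (val f i) s i) e.
  by rewrite !(nth_map i) -?enumT ?size_enum_ord // !nth_ord_enum.
apply: (inj_map val_inj).
apply: (irr_sorted_eq ltn_trans ltnn) => //.
have u h : uniq (map val (codom (val (h : plindex r n)))).
  exact: sorted_uniq ltn_trans ltnn _ (sorted_plindex h).
have sub : {subset map val (codom (val f)) <= map val (codom (val g))}.
  by move=> _ /mapP[_ /codomP[j ->] ->]; apply: map_f.
by have [|_] := uniq_min_size (u f) sub _; rewrite ?size_map.
Qed.

Section Field.
Variable K : fieldType.

Lemma wedgeE (b : 'M[K]_n) (w : plindex r n) :
  wedge r b *m wedge_basis K w = plucker (colsub (val w) b).
Proof.
rewrite /wedge_basis -colE; apply/colP => i; rewrite !mxE enum_rankK.
by congr (\det _); apply/matrixP => j k; rewrite !mxE.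
Qed.

(** For distinct index sets of equal size, the minor of a diagonal matrix has
    a zero row. *)
Lemma wedge_diagE (d : 'rV[K]_n) (x : 'cV[K]_(pldim r n)) i :
  (wedge r (diag_mx d) *m x) i 0 =
    (\prod_k d 0 (val (enum_val i : plindex r n) k)) * x i 0.
Proof.
rewrite mxE (bigD1 i) //= big1 ?addr0; last first.
  move=> j ji; rewrite mxE.
  have [k kj] : exists k, val (enum_val i : plindex r n) k \notin
                          codom (val (enum_val j : plindex r n)).
    apply/existsP; apply: contraNT ji; rewrite negb_exists => /forallP h.
    apply/eqP/enum_val_inj; apply/esym/plindex_codom_inj => k.
    exact/negPn/h.
  rewrite (expand_det_row _ k) big1 ?mul0r // => l _; rewrite !mxE.
  case: eqP => [e|]; last by rewrite mulr0n mul0r.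
  by case/negP: kj; rewrite e codom_f.
congr (_ * _); rewrite mxE.
transitivity (\det (diag_mx (\row_k d 0 (val (enum_val i : plindex r n) k)))).
  congr (\det _); apply/matrixP => k l; rewrite !mxE; congr (_ *+ nat_of_bool _).
  apply/idP/idP => [/eqP|/eqP -> //].
  case: (ltngtP k l) => [lt|lt|/val_inj -> //] e;
    by have := plindex_ltn (enum_val i : plindex r n) lt; rewrite e ltnn.
by rewrite det_diag; apply: eq_bigr => k _; rewrite mxE.
Qed.

Lemma plucker_diag (d : 'rV[K]_n) (A : 'M[K]_(n, r)) :
  plucker (diag_mx d *m A) = wedge r (diag_mx d) *m plucker A.
Proof.
apply/colP => i; rewrite wedge_diagE !mxE.
transitivity (\det (diag_mx (\row_k d 0 (val (enum_val i : plindex r n) k))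
                  *m rowsub (val (enum_val i : plindex r n)) A)).
  by congr (\det _); apply/matrixP => k l; rewrite !mul_diag_mx !mxE.
by rewrite det_mulmx det_diag; congr (_ * _); apply: eq_bigr => k _; rewrite mxE.
Qed.

(** A polynomial in the Plucker coordinates of a matrix with polynomial entries
    is a polynomial in the parameters. *)
Lemma plucker_mpoly m (A : 'M[{mpoly K[m]}]_(n, r)) (p : {mpoly K[pldim r n]}) :
  exists q : {mpoly K[m]}, forall v,
    q.@[v] = p.@[fun i => plucker (map_mx (meval v) A) i 0].
Proof.
exists (p \mPo [tuple plucker A i 0 | i < pldim r n]) => v.
rewrite comp_mpoly_meval; apply: meval_eq => i.
rewrite tnth_mktuple map_plucker [RHS]mxE; exact: erefl.
Qed.

End Field.
End Plucker.

Lemma dhomog_meval (K : comNzRingType) n d (p : {mpoly K[n]}) (c : K) (v : 'I_n -> K) :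
  p \is d.-homog -> p.@[fun i => c * v i] = c ^+ d * p.@[v].
Proof.
move=> /dhomogP hp; rewrite !mevalE mulr_sumr big_seq [RHS]big_seq.
apply: eq_bigr => m mp; rewrite mulrCA; congr (_ * _).
have -> : \prod_i (c * v i) ^+ m i = \prod_i (c ^+ m i * v i ^+ m i).
  by apply: eq_bigr => i _; rewrite exprMn.
by rewrite big_split /= prodrXr -mdegE hp.
Qed.

Lemma det_mx33 (R : comNzRingType) (A : 'M[R]_3) (a := fun i j => A (inord i) (inord j)) :
  \det A = a 0 0 * (a 1 1 * a 2 2 - a 1 2 * a 2 1)
         - a 0 1 * (a 1 0 * a 2 2 - a 1 2 * a 2 0)
         + a 0 2 * (a 1 0 * a 2 1 - a 1 1 * a 2 0).
Proof.
have det2 (B : 'M[R]_2) : \det B = B ord0 ord0 * B (lift ord0 ord0) (lift ord0 ord0)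
    - B ord0 (lift ord0 ord0) * B (lift ord0 ord0) ord0.
  rewrite (expand_det_row _ ord0) !big_ord_recl big_ord0 /cofactor !det_mx11 !mxE.
  rewrite /= /bump /= expr0 expr1 !mul1r mulN1r addr0 mulrN.
  by congr (_ * B _ _ - _ * B _ _); apply: val_inj.
have -> : A = \matrix_(i, j) a i j by apply/matrixP => i j; rewrite mxE /a !inord_val.
rewrite (expand_det_row _ ord0) !big_ord_recl big_ord0 /cofactor !det2 !mxE /=.
by rewrite /bump /=; ring.
Qed.

(** Indices counted from 0; the value is meaningful for increasing triples
    below 7. *)
Definition triple (T : nat * nat * nat) : plindex 3 7 :=
  insubd w37 [ffun l : 'I_3 => inord (nth 0%N [:: T.1.1; T.1.2; T.2] l)].

Lemma val_triple i j k l : (i < j < k)%N -> (k < 7)%N ->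
  val (triple (i, j, k)) l = inord (nth 0%N [:: i; j; k] l).
Proof.
move=> /andP[ij jk] k7; rewrite val_insubd ifT ?ffunE //.
apply/forallP => -[a ha]; apply/forallP => -[b hb]; apply/implyP; rewrite !ffunE /=.
case: a ha => [|[|[|a]]] ha //; case: b hb => [|[|[|b]]] hb //= _;
  rewrite !inordK //; lia.
Qed.

(** * Schubert varieties and their sections *)

Section Schubert.
Variables (K : fieldType) (r n : nat) (w : plindex r n).

Lemma borel_orbit_schubert (b : 'M[K]_n) :
  borel b -> schubert w (wedge r b *m wedge_basis K w).
Proof.
move=> hb; split=> [|d p _ /(_ _ hb) //]; case: hb => /is_trig_mxP bt db.
have bw i : b i i != 0.
  have : \det b^T != 0 by rewrite det_tr db oner_eq0.
  rewrite det_trig ?(introT is_trig_mxP bt) // (bigD1 i) //= mxE mulf_eq0.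
  by case/norP.
apply/eqP => /(congr1 (fun f => f (enum_rank w) 0)).
rewrite wedgeE !mxE enum_rankK -det_tr det_trig.
  by apply/eqP/prodf_neq0 => i _; rewrite !mxE.
apply/is_trig_mxP => i j ij; rewrite !mxE.
by have := bt (val w i) (val w j) (plindex_ltn w ij); rewrite mxE.
Qed.

Lemma schubert_scale (c : K) (x : 'cV[K]_(pldim r n)) :
  c != 0 -> schubert w x -> schubert w (c *: x).
Proof.
move=> cn0 [xn0 hx]; split.
  (* Nonvanishing of a vector is read in [schubert] as that of its coordinate
     function. *)
  apply: contraNneq xn0 => e; apply/eqP/funext => i; apply/funext => j.
  have /eqP := congr1 (fun f => f i j) e; rewrite mxE mulf_eq0 (negPf cn0).
  by move/eqP.
move=> d p hp pb; have := dhomog_meval c (fun i => x i 0) hp.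
rewrite (hx d p hp pb) mulr0 => <-; apply: meval_eq => i; by rewrite mxE.
Qed.

Local Notation S := (@schubert K r n w).

Definition schubert_pt x (hx : S x) : S := exist _ x (mem_set hx).

Lemma schubert_ptP (x : S) : schubert w (val x).
Proof. exact: set_mem (valP x). Qed.

Lemma global_section_scale d (F : S -> K) : global_section d F ->
  forall (c : K) (x y : S), c != 0 -> val y = c *: val x ->
  F y = c ^+ d * F x.
Proof.
move=> hF c x y cn0 e; have [k [f [g [hf hg gx Fg]]]] := hF x.
have ev p l : p \is l.-homog ->
    p.@[fun i => val y i 0] = c ^+ l * p.@[fun i => val x i 0].
  by move=> hp; rewrite -(dhomog_meval _ _ hp) e; apply: meval_eq => i; rewrite mxE.
rewrite !Fg ?(ev _ _ hg) ?mulf_neq0 ?expf_neq0 // (ev _ _ hf) exprD.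
by field; rewrite ?gx ?expf_neq0.
Qed.

End Schubert.

(** * The slice of X(3,5,7) *)

Lemma prod_ord (R : comNzRingType) n (F : 'I_n.+1 -> R) :
  \prod_(i < n.+1) F i = \prod_(0 <= i < n.+1) F (inord i).
Proof. by rewrite big_mkord; apply: eq_bigr => i _; rewrite inord_val. Qed.

Section TorusQuotient.
Variable K : numClosedFieldType.

Notation X := (@schubert K 3 7 w37).
Notation H m := (@quotient_section K 3 7 w37 7 m).

(** On a matrix [b] of the Borel subgroup, [stair] leaves the columns 3, 5 and 7
    unchanged. *)
Definition stair (R : comNzRingType) (B : 'M[R]_(7, 3)) : 'M[R]_(7, 3) :=
  \matrix_(i, j) if (i <= 2 * j + 2)%N then B i j else 0.

(** Representatives of the general staircase matrices under [T] and the column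
    operations; a two-dimensional torus still acts on them. *)
Definition slice (R : comNzRingType) (v : 'I_5 -> R) : 'M[R]_(7, 3) :=
  \matrix_(i, j)
    nth 0 (nth [::] [:: [:: 1; v (inord 0); v (inord 2)];
                        [:: 1; v (inord 1); v (inord 3)];
                        [:: 1; 0; 0];
                        [:: 0; 1; v (inord 4)];
                        [:: 0; 1; 0];
                        [:: 0; 0; 1];
                        [:: 0; 0; 1]] i) j.

Lemma val_w37 j : val w37 j = inord (2 * j + 2).
Proof. by rewrite SubK ffunE. Qed.

(** The condition says that the staircase columns complete to a matrix of the
    Borel subgroup; its first diagonal entry is chosen to make the determinant
    equal to 1. *)
Lemma stair_schubert (B : 'M[K]_(7, 3)) :
    B (inord 2) (inord 0) * B (inord 4) (inord 1) * B (inord 6) (inord 2) != 0 ->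
  schubert w37 (plucker (stair B)).
Proof.
set k := _ * _; move=> kn0.
pose b : 'M[K]_7 := \matrix_(i, j)
  if j == 2%N :> nat then stair B i (inord 0) else
  if j == 4%N :> nat then stair B i (inord 1) else
  if j == 6%N :> nat then stair B i (inord 2) else
  if i == j then if i == 0%N :> nat then k^-1 else 1 else 0.
have -> : stair B = colsub (val w37) b.
  apply/matrixP => i j; rewrite [RHS]mxE val_w37 [b _ _]mxE.
  by case: j => [[|[|[|j]]]] hj //=; rewrite !inordK //=; congr (stair B i _);
     apply: val_inj; rewrite /= inordK.
rewrite -wedgeE; apply: borel_orbit_schubert.
have bt : is_trig_mx b^T.
  apply/is_trig_mxP => i j ij; rewrite !mxE.
  case: ifP => [/eqP e|_]; first by rewrite e in ij; rewrite inordK // leqNgt ij.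
  case: ifP => [/eqP e|_]; first by rewrite e in ij; rewrite inordK // leqNgt ij.
  case: ifP => [/eqP e|_]; first by rewrite e in ij; rewrite inordK // leqNgt ij.
  by rewrite eq_sym -val_eqE ltn_eqF.
split=> //; rewrite -det_tr det_trig // prod_ord unlock /=.
rewrite !mxE !inordK // !eqxx /=.
rewrite /k in kn0 *; move: kn0; rewrite !mulf_eq0 !negb_or => /andP[/andP[h1 h2] h3].
by field; rewrite h1 h2 h3.
Qed.

Lemma stair_slice (v : 'I_5 -> K) : stair (slice v) = slice v.
Proof.
apply/matrixP => i j; rewrite !mxE.
by case: i => [[|[|[|[|[|[|[|i]]]]]]] hi] //; case: j => [[|[|[|j]]] hj].
Qed.

Lemma slice_schubert (v : 'I_5 -> K) : schubert w37 (plucker (slice v)).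
Proof.
rewrite -stair_slice; apply: stair_schubert.
by rewrite !mxE !inordK //= !mulr1 oner_eq0.
Qed.

Definition slice_pt (v : 'I_5 -> K) : X := schubert_pt (slice_schubert v).

(** A general staircase matrix is moved into the slice by [T] and by upper
    triangular column operations.  The rows 3, 5 and 7 of [B] give [U]; then
    [t] makes the entries (1,1), (2,1), (4,2) and (6,3) equal to 1. *)
Lemma stair_factor (B : 'M[K]_(7, 3)) (b := fun i j => B (inord i) (inord j)) :
    b 0 0 * b 1 0 * b 2 0 * b 3 1 * b 4 1 * b 5 2 * b 6 2 != 0 ->
  exists (t : 'rV[K]_7) (v : 'I_5 -> K) (U : 'M[K]_3), [/\ \prod_i t 0 i != 0, \det U != 0 &
    stair B = diag_mx t *m slice v *m U].
Proof.
rewrite !mulf_eq0 !negb_or => /andP[/andP[/andP[/andP[/andP[/andP[h0 h1] h2] h3] h4] h5] h6].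
pose t0 := b 0 0 / b 2 0; pose t1 := b 1 0 / b 2 0.
pose t3 := b 3 1 / b 4 1; pose t5 := b 5 2 / b 6 2.
pose v0 := (b 0 1 / t0 - b 2 1) / b 4 1.
pose v1 := (b 1 1 / t1 - b 2 1) / b 4 1.
pose v2 := (b 0 2 / t0 - b 2 2 - v0 * b 4 2) / b 6 2.
pose v3 := (b 1 2 / t1 - b 2 2 - v1 * b 4 2) / b 6 2.
pose v4 := (b 3 2 / t3 - b 4 2) / b 6 2.
pose U : 'M[K]_3 := \matrix_(i, j)
  nth 0 (nth [::] [:: [:: b 2 0; b 2 1; b 2 2];
                      [:: 0; b 4 1; b 4 2];
                      [:: 0; 0; b 6 2]] i) j.
exists (\row_i nth 1 [:: t0; t1; 1; t3; 1; t5; 1] i).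
exists (fun i => nth 0 [:: v0; v1; v2; v3; v4] i), U; split.
- rewrite prod_ord unlock /= !mxE !inordK //=.
  by rewrite !mulf_neq0 ?invr_eq0 ?oner_neq0.
- rewrite -det_tr det_trig; last first.
    by apply/is_trig_mxP => -[[|[|[|i]]] hi] [[|[|[|j]]] hj] //= _; rewrite !mxE.
  by rewrite prod_ord unlock /= !mxE !inordK //= !mulf_neq0 ?oner_neq0.
- have -> : stair B = \matrix_(i, j) if (i <= 2 * j + 2)%N then b i j else 0.
    by apply/matrixP => i j; rewrite !mxE /b !inord_val.
  apply/matrixP => i j; rewrite mul_diag_mx !mxE !big_ord_recl big_ord0 !mxE.
  rewrite /= !inordK //=.
  case: i => [[|[|[|[|[|[|[|i]]]]]]] hi] //; case: j => [[|[|[|j]]] hj] //=.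
  all: rewrite /v2 /v3 /v4 /v1 /v0 /t0 /t1 /t3 /t5; field; rewrite ?h0 ?h1 ?h2 ?h3 ?h4 ?h5 ?h6 //.
Qed.

Section TorusWeight.
Variables (m : nat) (F : X -> K).
Hypothesis hF : H m F.

(** Invariance is assumed for determinant 1 only.  A diagonal matrix of
    determinant [d^7] is [d] times one of determinant 1, and the scalar [d] acts
    through the homogeneity of sections: it multiplies Plucker coordinates by
    [d^3], and a section of degree [7m] by [(d^7)^(3m)]. *)
Lemma section_torus (t : 'rV[K]_7) (c : K) (x y : X) :
  \prod_i t 0 i != 0 -> c != 0 -> val y = c *: (wedge 3 (diag_mx t) *m val x) ->
  F y = c ^+ (7 * m) * (\prod_i t 0 i) ^+ (3 * m) * F x.
Proof.
set T := \prod_i _; move=> Tn0 cn0 ey; have [gF tF] := hF.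
pose d := 7.-root T; have dT : d ^+ 7 = T by rewrite rootCK.
have dn0 : d != 0 by apply: contraNneq Tn0 => d0; rewrite -dT d0 expr0n.
have kn0 : c * d ^+ 3 != 0 by rewrite mulf_neq0 ?expf_neq0.
pose y' := schubert_pt (schubert_scale (invr_neq0 kn0) (schubert_ptP y)).
have yy' : val y = (c * d ^+ 3) *: val y' by rewrite scalerA divff ?scale1r.
rewrite (global_section_scale gF kn0 yy') (tF (diag_mx (d^-1 *: t)) _ x y').
- by rewrite -dT -exprM exprMn -exprM; congr (_ * _ ^+ _ * _); lia.
- split; first exact: diag_mx_is_diag.
  rewrite det_diag; under eq_bigr do rewrite mxE.
  by rewrite big_split /= prodr_const card_ord exprVn dT mulVf.
- apply/colP => i; rewrite wedge_diagE !mxE ey mxE wedge_diagE.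
  under [in RHS]eq_bigr do rewrite mxE.
  rewrite big_split /= prodr_const card_ord.
  by field; rewrite cn0 dn0.
Qed.

End TorusWeight.

(** Density of the [T]-orbits of the slice.  Near a given point the two sections
    are quotients [f / g] and [f' / g'], and the homogeneous polynomial
    [D = (f g' - f' g) g g'] vanishes at every point of the cone where the
    sections agree.  By [stair_factor] that holds for general staircase
    matrices, hence, by density in the affine space of these matrices, on the
    whole Borel orbit, hence on its closure. *)
Lemma eq_section_slice m (F F' : X -> K) : H m F -> H m F' ->
  (forall v, F (slice_pt v) = F' (slice_pt v)) -> F = F'.
Proof.
move=> hF hF' FF'; apply/funext => x.
have [k [f [g [hf hg gx Fg]]]] := hF.1 x.
have [k' [f' [g' [hf' hg' gx' Fg']]]] := hF'.1 x.
pose D := (f * g' - f' * g) * (g * g').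
suff : D.@[fun i => val x i 0] = 0.
  rewrite /D !(mevalM, mevalB) => /eqP.
  rewrite mulf_eq0 [_ * _ == 0 in X in _ || X]mulf_eq0 (negPf gx) (negPf gx') !orbF.
  rewrite subr_eq0 => e; rewrite Fg // Fg' //.
  by apply/eqP; rewrite eqr_div.
have hD : D \is (7 * m + k + k' + (k + k'))%N.-homog.
  apply: dhomogM; last exact: dhomogM.
  apply: rpredB; first exact: dhomogM.
  rewrite addnAC; exact: dhomogM.
case: (schubert_ptP x) => _ /(_ _ D hD); apply=> b bb.
pose ix (i : 'I_7) (j : 'I_3) := mxvec_index i j.
(* [q] is [D] at the Plucker coordinates of a generic staircase matrix. *)
have [q eq] := plucker_mpoly (stair (\matrix_(i, j) 'X_(ix i j))) D.
pose mat (v : 'I_(7 * 3) -> K) : 'M[K]_(7, 3) := \matrix_(i, j) v (ix i j).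
have {}eq v : q.@[v] = D.@[fun i => plucker (stair (mat v)) i 0].
  rewrite eq; apply: meval_eq => i; congr (plucker _ i 0); apply/matrixP => s t.
  by rewrite !mxE; case: ifP; rewrite ?mxE ?mevalXU ?meval0.
have q0 : q = 0.
  pose y i j : {mpoly K[7 * 3]} := 'X_(ix (inord i) (inord j)).
  apply: (@mpoly_eq0_dense _ _ _
    (y 0 0 * y 1 0 * y 2 0 * y 3 1 * y 4 1 * y 5 2 * y 6 2)).
    by rewrite !mulf_neq0 // -msupp_eq0 msuppX.
  move=> v; rewrite !mevalM !mevalXU eq => hv.
  have := @stair_factor (mat v); rewrite /= !mxE => /(_ hv)[t [u [U [tn0 Un0 e]]]].
  have hs : schubert w37 (plucker (stair (mat v))).
    apply: stair_schubert; rewrite !mxE; move: hv.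
    by rewrite !mulf_eq0 !negb_or => /andP[/andP[/andP[/andP[/andP[/andP[_ _] ->] _] ->] _] ->].
  pose z := schubert_pt hs.
  have ez : val z = \det U *: (wedge 3 (diag_mx t) *m val (slice_pt u)).
    by rewrite /= e pluckerM plucker_diag.
  have Fz := section_torus hF tn0 Un0 ez.
  have Fz' := section_torus hF' tn0 Un0 ez.
  rewrite FF' -Fz' in Fz.
  have /= := Fg z; have /= := Fg' z; rewrite Fz.
  rewrite /D !(mevalM, mevalB).
  have [->|gz] := eqVneq (g.@[_]) 0; first by rewrite mul0r mulr0.
  have [->|gz'] := eqVneq (g'.@[_]) 0; first by rewrite !mulr0.
  move=> /(_ isT) -> /(_ isT) /eqP; rewrite eqr_div // => /eqP ->.
  by rewrite subrr mul0r.
have := eq (fun k => mxvec (colsub (val w37) b) 0 k); rewrite q0 meval0 => ->.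
apply: meval_eq => i; rewrite wedgeE; congr (plucker _ i 0); apply/matrixP => s t.
rewrite !mxE; case: leqP => [_|lt]; first by rewrite mxvecE mxE.
have [/is_trig_mxP /(_ (val w37 t) s)] := bb; rewrite mxE => -> //.
by rewrite val_w37 inordK //; case: t {lt} => [[|[|[|t]]] ht].
Qed.

(** * Restriction of invariant sections to the slice *)

(** The diagonal matrices that preserve the slice, up to a rescaling of the three
    columns, act on its coordinates with two independent weights. *)
Lemma slice_rescale (a b : K) (v : 'I_5 -> K) : a != 0 -> b != 0 ->
  plucker (slice (fun i => nth 0 [:: a; a; a * b; a * b; b] i * v i)) =
  (b / a) *: (wedge 3 (diag_mx (\row_i nth 0 [:: a; a; a; 1; 1; b^-1; b^-1] i))
                *m plucker (slice v)).
Proof.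
move=> an0 bn0.
rewrite -plucker_diag.
pose d : 'rV[K]_3 := \row_i nth 0 [:: a^-1; 1; b] i.
have -> : b / a = \det (diag_mx d).
  by rewrite det_diag prod_ord unlock /= !mxE !inordK //=; ring.
rewrite -pluckerM; congr plucker; apply/matrixP => i j.
rewrite mul_mx_diag mul_diag_mx !mxE !inordK //=.
case: i => [[|[|[|[|[|[|[|i]]]]]]] hi] //; case: j => [[|[|[|j]]] hj] //=.
all: by field; rewrite ?an0 ?bn0.
Qed.

Lemma section_slice_rescale m (F : X -> K) (a b : K) (v : 'I_5 -> K) :
  H m F -> a != 0 -> b != 0 ->
  F (slice_pt (fun i => nth 0 [:: a; a; a * b; a * b; b] i * v i)) =
  a ^+ (2 * m) * b ^+ m * F (slice_pt v).
Proof.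
move=> hF an0 bn0.
set t := \row_i nth 0 [:: a; a; a; 1; 1; b^-1; b^-1] i : 'rV[K]_7.
have et : \prod_i t 0 i = a ^+ 3 / b ^+ 2.
  by rewrite prod_ord unlock /= !mxE !inordK //=; field.
have := @section_torus m F hF t (b / a) (slice_pt v) (slice_pt _)
  _ _ (slice_rescale v an0 bn0).
move=> ->.
- rewrite et; congr (_ * _); rewrite !exprMn !exprVn !exprM.
  rewrite -!exprVn -!exprMn; congr (_ ^+ _).
  by field; rewrite an0 bn0.
- by rewrite et mulf_neq0 ?invr_eq0 ?expf_neq0.
- by rewrite mulf_neq0 ?invr_eq0.
Qed.

(** The action of [slice_rescale] with [a = b] contracts the slice, so the
    restriction is a polynomial by [contracting_regular_mpoly].  Rescaling by
    [a = 2] alone and by [b = 2] alone gives the two conditions on exponents. *)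
Lemma section_slice_mpoly m (F : X -> K) : H m F ->
  exists P : {mpoly K[5]}, (forall v, F (slice_pt v) = P.@[v]) /\
    forall u, u \in msupp P ->
      (u (inord 0%N) + u (inord 1%N) + u (inord 2) + u (inord 3) = 2 * m /\
       u (inord 2) + u (inord 3) + u (inord 4) = m)%N.
Proof.
move=> hF; have [k [f [g [_ _ g0 Fg]]]] := hF.1 (slice_pt (fun=> 0)).
pose gslice : 'M[{mpoly K[5]}]_(7, 3) := slice (fun i => 'X_i).
have ev v : map_mx (meval v) gslice = slice v.
  apply/matrixP => i j; rewrite !mxE.
  by case: i => [[|[|[|[|[|[|[|i]]]]]]] hi] //; case: j => [[|[|[|j]]] hj] //=;
    rewrite ?mevalXU ?meval0 ?meval1.
have [f' ef] := plucker_mpoly gslice f; have [g' eg] := plucker_mpoly gslice g.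
have [P eP] : exists P : {mpoly K[5]}, forall v, F (slice_pt v) = P.@[v].
  apply: (@contracting_regular_mpoly _ _ (nth 1%N [:: 1; 1; 2; 2]%N) (3 * m) _ f' g').
  - by case=> [[|[|[|[|[|i]]]]]].
  - move=> c v cn0; rewrite (mulSnr 2 m) exprD.
    rewrite -(section_slice_rescale _ hF) //; congr F; congr slice_pt.
    by apply/funext => -[[|[|[|[|[|i]]]]] hi].
  - by rewrite eg ev.
  - by move=> v; rewrite eg ef ev; apply: (Fg (slice_pt v)).
exists P; split=> // u uP.
have n2 : (2%:R : K) != 0 by rewrite pnatr_eq0.
have n1 : (1 : K) != 0 by rewrite oner_eq0.
have inj2 : injective (GRing.exp (2%:R : K)).
  by apply: ieexprIn; rewrite ?ltr0n // -[1]/(1%:R) eqr_nat.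
pose c a b : 'I_5 -> K := fun i => nth 0 [:: a; a; a * b; a * b; b] i.
have sc a b : a != 0 -> b != 0 -> \prod_i c a b i ^+ u i = a ^+ (2 * m) * b ^+ m.
  move=> an0 bn0; apply: mpoly_rescale_supp uP => v.
  by rewrite -!eP -section_slice_rescale.
split; apply: inj2.
  have := sc _ _ n2 n1; rewrite prod_ord unlock /= /c !inordK //=.
  by rewrite !expr1n !mulr1 => <-; rewrite !exprD; ring.
have := sc _ _ n1 n2; rewrite prod_ord unlock /= /c !inordK //=.
by rewrite !mul1r !expr1n !mul1r mulr1 => <-; rewrite !exprD; ring.
Qed.

(** The monomials allowed by [section_slice_mpoly] for [m = 1]. *)
Definition slice_gen (R : comNzRingType) (v : 'I_5 -> R) (l : 'I_7) : R :=
  let x k := v (inord k) in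
  nth 0 [:: x 4%N * x 0%N ^+ 2; x 4%N * (x 0%N * x 1%N); x 4%N * x 1%N ^+ 2;
            x 2%N * x 0%N; x 2%N * x 1%N; x 3%N * x 0%N; x 3%N * x 1%N] l.

(** Divide by generators one at a time: a factor [x4] is taken together with two
    of the variables [x0], [x1], and a factor [x2] or [x3] with one of them.
    The relation between the exponents guarantees that enough are left. *)
Lemma slice_monomial (i j k l n : nat) : (i + j = k + l + 2 * n)%N ->
  exists p : {mpoly K[7]}, p \is (k + l + n).-homog /\
    forall v : 'I_5 -> K, v (inord 0) ^+ i * v (inord 1) ^+ j *
      v (inord 2) ^+ k * v (inord 3) ^+ l * v (inord 4) ^+ n = p.@[slice_gen v].
Proof.
pose mon (v : 'I_5 -> K) i j k l n := v (inord 0) ^+ i * v (inord 1) ^+ j *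
  v (inord 2) ^+ k * v (inord 3) ^+ l * v (inord 4) ^+ n.
pose good i j k l n := exists p : {mpoly K[7]}, p \is (k + l + n).-homog /\
  forall v, mon v i j k l n = p.@[slice_gen v].
rewrite -/(good i j k l n).
have step (g : 'I_7) i' j' k' l' n' i1 j1 k1 l1 n1 : good i' j' k' l' n' ->
    (k1 + l1 + n1 = 1 + (k' + l' + n'))%N ->
    (forall v, mon v i1 j1 k1 l1 n1 = slice_gen v g * mon v i' j' k' l' n') ->
    good i1 j1 k1 l1 n1.
  move=> [p [hp ep]] e em; exists ('X_g * p); split.
    by rewrite e; apply: dhomogM; rewrite // dhomogX /= mdeg1.
  by move=> v; rewrite em mevalM mevalXU ep.
move: {2}(k + l + n)%N (erefl (k + l + n)%N) => N.
elim: N i j k l n => [|N IH] i j k l n eN eij.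
  have [-> -> -> -> ->] : [/\ i = 0, j = 0, k = 0, l = 0 & n = 0]%N.
    by split; lia.
  exists 1; split; first exact: dhomog1.
  by move=> v; rewrite /mon !expr0 !mulr1 meval1.
have gen v g (hg : (g < 7)%N) : @slice_gen K v (inord g) =
    let x k := v (inord k) in
  nth 0 [:: x 4%N * x 0%N ^+ 2; x 4%N * (x 0%N * x 1%N); x 4%N * x 1%N ^+ 2;
            x 2%N * x 0%N; x 2%N * x 1%N; x 3%N * x 0%N; x 3%N * x 1%N] g.
  by rewrite /slice_gen inordK.
case: n => [|n] in eN eij *; last first.
  case: i => [|[|i]] in eij *.
  - case: j => [|[|j]] in eij *; [lia|lia|].
    apply: (step (inord 2) 0 j k l n)%N => [||v]; [apply: IH; lia|lia|].
    by rewrite gen //= /mon !exprS; ring.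
  - case: j => [|j] in eij *; first lia.
    apply: (step (inord 1) 0 j k l n)%N => [||v]; [apply: IH; lia|lia|].
    by rewrite gen //= /mon !exprS; ring.
  - apply: (step (inord 0) i j k l n)%N => [||v]; [apply: IH; lia|lia|].
    by rewrite gen //= /mon !exprS; ring.
case: k => [|k] in eN eij *; last first.
  case: i => [|i] in eij *.
  - case: j => [|j] in eij *; first lia.
    apply: (step (inord 4) 0 j k l 0)%N => [||v]; [apply: IH; lia|lia|].
    by rewrite gen //= /mon !exprS; ring.
  - apply: (step (inord 3) i j k l 0)%N => [||v]; [apply: IH; lia|lia|].
    by rewrite gen //= /mon !exprS; ring.
case: l => [|l] in eN eij *; first lia.
case: i => [|i] in eij *.
- case: j => [|j] in eij *; first lia.
  apply: (step (inord 6) 0 j 0 l 0)%N => [||v]; [apply: IH; lia|lia|].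
  by rewrite gen //= /mon !exprS; ring.
- apply: (step (inord 5) i j 0 l 0)%N => [||v]; [apply: IH; lia|lia|].
  by rewrite gen //= /mon !exprS; ring.
Qed.

Lemma slice_mpoly_gens (P : {mpoly K[5]}) :
    (forall u, u \in msupp P ->
      (u (inord 0%N) + u (inord 1%N) =
       u (inord 2) + u (inord 3) + 2 * u (inord 4))%N) ->
  exists p : {mpoly K[7]}, (forall v, P.@[v] = p.@[slice_gen v]) /\
    forall m, (forall u, u \in msupp P ->
      (u (inord 2) + u (inord 3) + u (inord 4) = m)%N) -> p \is m.-homog.
Proof.
move=> hP; pose S m (s : seq 'X_{1..5}) := forall u, u \in s ->
      (u (inord 2) + u (inord 3) + u (inord 4) = m)%N.
suff [p [ep hp]] : exists p : {mpoly K[7]},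
    (forall v, \sum_(u <- msupp P) P@_u * \prod_i v i ^+ u i = p.@[slice_gen v]) /\
    forall m, S m (msupp P) -> p \is m.-homog.
  by exists p; split=> // v; rewrite mevalE.
elim: (msupp P) hP => [|u s IH] hs.
  exists 0; split=> [v|m _]; last exact: dhomog0.
  by rewrite big_nil meval0.
have [|p [ep hp]] := IH; first by move=> u' us; apply: hs; rewrite inE us orbT.
have [q [hq eq]] := slice_monomial (hs u (mem_head _ _)).
exists (P@_u *: q + p); split=> [v|m hm].
  rewrite big_cons mevalD mevalZ -eq -ep; congr (_ * _ + _).
  by rewrite prod_ord unlock /= mulr1 !mulrA.
apply: rpredD; first by apply: rpredZ; rewrite -(hm u (mem_head _ _)).
by apply: hp => u' us; apply: hm; rewrite inE us orbT.
Qed.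

(** * Generators of the ring of sections *)

Lemma plucker_triple (A : 'M[K]_(7, 3)) i j k
    (a := fun s t => A (inord s) (inord t)) : (i < j < k)%N -> (k < 7)%N ->
  plucker A (enum_rank (triple (i, j, k))) 0 =
    a i 0 * (a j 1 * a k 2 - a j 2 * a k 1)
  - a i 1 * (a j 0 * a k 2 - a j 2 * a k 0)
  + a i 2 * (a j 0 * a k 1 - a j 1 * a k 0).
Proof.
move=> ijk k7; rewrite mxE enum_rankK det_mx33.
by rewrite !mxE !val_triple // !inordK.
Qed.

(** Each of these monomials of degree 7 in the Plucker coordinates contains
    every row index exactly three times, which makes it [T]-invariant; they are
    chosen to restrict, up to sign, to the monomials [slice_gen]. *)
Definition gen_triples (l : 'I_7) : seq (nat * nat * nat) :=
  nth [::]
    [:: [:: (0,2,5); (0,2,5); (0,3,5); (1,3,6); (1,4,6); (1,4,6); (2,3,4)];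
        [:: (0,2,5); (1,2,5); (2,3,4); (0,3,5); (0,3,6); (1,4,6); (1,4,6)];
        [:: (1,2,5); (1,2,5); (1,3,5); (0,3,6); (0,4,6); (0,4,6); (2,3,4)];
        [:: (0,2,4); (0,2,5); (2,3,5); (0,3,5); (1,3,6); (1,4,6); (1,4,6)];
        [:: (0,2,4); (1,2,5); (2,3,5); (0,3,5); (0,3,6); (1,4,6); (1,4,6)];
        [:: (1,2,4); (0,2,5); (2,3,5); (1,3,5); (1,3,6); (0,4,6); (0,4,6)];
        [:: (1,2,4); (1,2,5); (2,3,5); (1,3,5); (0,3,6); (0,4,6); (0,4,6)]]%N l.

Lemma gen_triples_ok l :
  all (fun T => (T.1.1 < T.1.2 < T.2)%N && (T.2 < 7)%N) (gen_triples l).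
Proof. by case: l => [[|[|[|[|[|[|[|l]]]]]]] hl]. Qed.

Definition gen_mpoly (l : 'I_7) : {mpoly K[pldim 3 7]} :=
  - \prod_(T <- gen_triples l) 'X_(enum_rank (triple T)).

Definition gen (l : 'I_7) (x : X) : K := (gen_mpoly l).@[fun i => val x i 0].

Lemma gen_mpoly_homog l : gen_mpoly l \is 7.-homog.
Proof.
rewrite rpredN; suff h s : \prod_(T <- s) 'X_(enum_rank (triple T)) \is
    [in K[pldim 3 7], (size s).-homog].
  have e : size (gen_triples l) = 7%N by case: l => [[|[|[|[|[|[|[|l]]]]]]] hl].
  by have := h (gen_triples l); rewrite e.
elim: s => [|T s IH]; first by rewrite big_nil dhomog1.
by rewrite big_cons /= -[(size s).+1]add1n; apply: dhomogM; rewrite // dhomogX /= mdeg1.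
Qed.

Lemma gen_torus l t (x y : X) : torus t -> val y = wedge 3 t *m val x ->
  gen l y = gen l x.
Proof.
case=> /diag_mxP[d ->]; rewrite det_diag => dd ey.
rewrite /gen /gen_mpoly !mevalN !rmorph_prod /=; congr (- _).
pose D (T : nat * nat * nat) := d 0 (inord T.1.1) * d 0 (inord T.1.2) * d 0 (inord T.2).
transitivity (\prod_(T <- gen_triples l)
   (D T * ('X_(enum_rank (triple T)) : {mpoly K[_]}).@[fun i => val x i 0])).
  apply: eq_big_seq => T hT; rewrite !mevalXU ey wedge_diagE; congr (_ * _).
  have {hT} : ((T.1.1 < T.1.2 < T.2)%N && (T.2 < 7)%N).
    exact: (allP (gen_triples_ok l)).
  case: T => [[i j] k] /andP[ijk k7]; rewrite enum_rankK prod_ord unlock /=.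
  by rewrite !val_triple // !inordK //= mulr1 mulrA.
rewrite big_split /=; suff -> : \prod_(T <- gen_triples l) D T = (\prod_i d 0 i) ^+ 3.
  by rewrite dd expr1n mul1r.
rewrite prod_ord unlock /D.
by case: l => [[|[|[|[|[|[|[|l]]]]]]] hl] //=; ring.
Qed.

Lemma gen_slice l (v : 'I_5 -> K) : gen l (slice_pt v) = slice_gen v l.
Proof.
rewrite /gen /gen_mpoly mevalN rmorph_prod /=.
pose x k := v (inord k).
pose row (i : nat) : K * K * K := nth (0, 0, 0)
  [:: (1, x 0%N, x 2%N); (1, x 1%N, x 3%N); (1, 0, 0); (0, 1, x 4%N); (0, 1, 0); (0, 0, 1); (0, 0, 1)] i.
pose minor (T : nat * nat * nat) :=
  let: (a0, a1, a2) := row T.1.1 in let: (b0, b1, b2) := row T.1.2 in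
  let: (c0, c1, c2) := row T.2 in
  a0 * (b1 * c2 - b2 * c1) - a1 * (b0 * c2 - b2 * c0) + a2 * (b0 * c1 - b1 * c0).
have sliceE i : (i < 7)%N -> row i =
    (slice v (inord i) (inord 0), slice v (inord i) (inord 1), slice v (inord i) (inord 2)).
  by move=> hi; rewrite !mxE !inordK //; case: i hi => [|[|[|[|[|[|[|i]]]]]]].
transitivity (- \prod_(T <- gen_triples l) minor T).
  congr (- _); apply: eq_big_seq => T /(allP (gen_triples_ok l)).
  case: T => [[i j] k] /= /andP[ijk k7]; have /andP[ij jk] := ijk.
  rewrite mevalXU plucker_triple // /minor /= !sliceE //; lia.
rewrite unlock /minor /slice_gen /x.
by case: l => [[|[|[|[|[|[|[|l]]]]]]] hl] //=; rewrite /x; ring.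
Qed.

Lemma gens_section m (p : {mpoly K[7]}) : p \is m.-homog ->
  H m (fun x => p.@[gen^~ x]).
Proof.
move=> /dhomogP hp; split; last first.
  move=> t ht x y e; apply: meval_eq => l; exact: gen_torus ht e.
move=> x; exists 0%N, (p \mPo [tuple gen_mpoly l | l < 7]), 1; split.
- rewrite addn0 comp_mpolyE big_seq; apply: rpred_sum => u up; apply: rpredZ.
  have -> : (7 * m = \sum_i 7 * u i)%N by rewrite -big_distrr /= -mdegE (hp u up).
  apply: (big_rec2 (fun q d => q \is d.-homog)) => [|i d q _ hq]; first exact: dhomog1.
  by apply: dhomogM hq; rewrite tnth_mktuple; apply/dhomogMn/gen_mpoly_homog.
- exact: dhomog1.
- by rewrite meval1 oner_neq0.
- move=> y _; rewrite meval1 divr1 comp_mpoly_meval; apply: meval_eq => l.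
  by rewrite tnth_mktuple.
Qed.

Lemma section_gens m (F : X -> K) : H m F ->
  exists p : {mpoly K[7]}, p \is m.-homog /\ F = (fun x => p.@[gen^~ x]).
Proof.
move=> hF; have [P [eP wP]] := section_slice_mpoly hF.
have [u /wP[]|p [ep hp]] := @slice_mpoly_gens P; first lia.
have {}hp : p \is m.-homog by apply: hp => u /wP[].
exists p; split=> //; apply: eq_section_slice hF (gens_section hp) _ => v.
by rewrite eP ep; apply: meval_eq => l; rewrite gen_slice.
Qed.

(** By [section_gens], the ring of sections is the subalgebra generated by the
    seven functions [gen]. *)
Lemma section_ringP (F : X -> K) :
  section_ring (fun m => H m) F <-> exists p : {mpoly K[7]}, F = (fun x => p.@[gen^~ x]).
Proof.
split=> [[n [s [hs ->]]]|[p ->]].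
  have [p hp] := choice (fun m => section_gens (hs m)).
  exists (\sum_(m < n) p m); apply/funext => x.
  rewrite fct_sumE raddf_sum /=; apply: eq_bigr => m _; by have [_ ->] := hp m.
exists (msize p), (fun m x => (pihomog mdeg m p).@[gen^~ x]); split.
  by move=> m; apply: gens_section; apply: pihomogP.
apply/funext => x; rewrite {1}(pihomog_partitionE (leqnn (msize p))).
by rewrite fct_sumE raddf_sum.
Qed.

(** The slice has a rescaling that multiplies all the [slice_gen] by a common
    factor, so vanishing on the slice passes to the homogeneous parts of [p],
    to which [eq_section_slice] applies. *)
Lemma gens_slice_inj (p : {mpoly K[7]}) :
  (forall v : 'I_5 -> K, p.@[slice_gen v] = 0) -> forall x, p.@[gen^~ x] = 0.
Proof.
move=> hp x; rewrite (pihomog_partitionE (leqnn (msize p))) raddf_sum /=.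
apply: big1 => d _; set q := pihomog _ _ _.
have hq : q \is d.-homog by apply: pihomogP.
suff e : (fun x : X => q.@[gen^~ x]) = (fun x => (0 : {mpoly K[7]}).@[gen^~ x]).
  by have := congr1 (fun f => f x) e; rewrite /= meval0.
have h0 : (0 : {mpoly K[7]}) \is d.-homog by apply: rpred0.
apply: (eq_section_slice (gens_section hq) (gens_section h0)) => v.
rewrite meval0; rewrite (meval_eq _ (gen_slice^~ v)).
pose r := \poly_(k < msize p) (pihomog mdeg k p).@[slice_gen v].
have r0 : r = 0.
  apply: poly_eq0_fun => c; rewrite horner_poly.
  pose v' (i : 'I_5) := nth 0 [:: 1; 1; c; c; c] i * v i.
  rewrite -[RHS](hp v') [in RHS](pihomog_partitionE (leqnn (msize p))) raddf_sum /=.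
  apply: eq_bigr => k _; rewrite mulrC -(dhomog_meval _ _ (pihomogP mdeg k p)).
  apply: meval_eq => l; rewrite /slice_gen /v' !inordK //=.
  by case: l => [[|[|[|[|[|[|[|l]]]]]]] hl] //=; ring.
by have := congr1 (fun r : {poly K} => r`_d) r0; rewrite coef_poly ltn_ord coef0.
Qed.

(** * Projective normality *)

Lemma slice_gen_mpoly (p : {mpoly K[7]}) : exists P : {mpoly K[5]},
  forall v, P.@[v] = p.@[slice_gen v].
Proof.
exists (p \mPo [tuple slice_gen (fun i => 'X_i : {mpoly K[5]}) l | l < 7]) => v.
rewrite comp_mpoly_meval; apply: meval_eq => l; rewrite tnth_mktuple /slice_gen.
by case: l => [[|[|[|[|[|[|[|l]]]]]]] hl] //=; rewrite !mevalM ?rmorphXn /= ?mevalXU.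
Qed.

(** The polynomials in the [slice_gen] are the invariants of the multiplicative
    group acting on [x0, ..., x4] with weights 1, 1, -1, -1, -2.  A quotient [R]
    of two invariants is invariant; the element 2, of infinite order in the
    group, is enough to test it. *)
Lemma slice_quotient_gens (p q : {mpoly K[7]}) (P Q R : {mpoly K[5]}) :
    (forall v, P.@[v] = p.@[slice_gen v]) ->
    (forall v, Q.@[v] = q.@[slice_gen v]) ->
    Q != 0 -> P = R * Q ->
  exists r : {mpoly K[7]}, forall v, R.@[v] = r.@[slice_gen v].
Proof.
move=> eP eQ Qn0 ePR.
have n2 : (2 : K) != 0 by rewrite pnatr_eq0.
pose c (i : 'I_5) : K := nth 0 [:: 2; 2; 2^-1; 2^-1; 2^-1 ^+ 2] i.
have gen_c v : slice_gen (fun i => c i * v i) =1 slice_gen v.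
  move=> l; rewrite /slice_gen /c !inordK //=.
  by case: l => [[|[|[|[|[|[|[|l]]]]]]] hl] //=; field.
have [R' eR'] : exists R' : {mpoly K[5]}, forall v, R'.@[v] = R.@[fun i => c i * v i].
  exists (R \mPo [tuple c i *: 'X_i | i < 5]) => v; rewrite comp_mpoly_meval.
  by apply: meval_eq => i; rewrite tnth_mktuple mevalZ mevalXU.
have R'R : R' - R = 0.
  apply: (mpoly_eq0_dense Qn0) => v Qv.
  rewrite mevalB eR'; apply/eqP; rewrite subr_eq0; apply/eqP/(mulIf Qv).
  rewrite -mevalM -ePR eP -(meval_eq _ (gen_c v)) -eP ePR mevalM; congr (_ * _).
  by rewrite !eQ; apply: meval_eq => l; rewrite gen_c.
have cR v : R.@[fun i => c i * v i] = 1 * R.@[v].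
  by rewrite mul1r -eR'; congr (_.@[_]); apply/eqP; rewrite -subr_eq0 R'R.
have [u /(mpoly_rescale_supp cR)|r [er _]] := @slice_mpoly_gens R; last by exists r.
rewrite prod_ord unlock /= /c !inordK //= => e.
have inj2 : injective (GRing.exp (2 : K)).
  by apply: ieexprIn; rewrite ?ltr0n // -[1]/(1%:R) eqr_nat.
apply/inj2/divr1_eq; rewrite -[RHS]e -exprM.
by move: (2 * u _)%N => k; rewrite !exprD !invfM !exprVn mulr1 !mulrA.
Qed.

Lemma gens_slice_eq (p q : {mpoly K[7]}) :
  (forall v : 'I_5 -> K, p.@[slice_gen v] = q.@[slice_gen v]) ->
  forall x : X, p.@[gen^~ x] = q.@[gen^~ x].
Proof.
move=> e x; apply/eqP; rewrite -subr_eq0 -mevalB; apply/eqP.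
by apply: gens_slice_inj => v; rewrite mevalB e subrr.
Qed.

(** Restriction to the slice identifies the ring of sections with a subring of
    the normal ring of polynomials in five variables, closed under exact
    division by [slice_quotient_gens]. *)
Lemma normal_section_ring : normal_subring (section_ring (fun m => H m)).
Proof.
have at_slice (p : {mpoly K[7]}) v : p.@[gen^~ (slice_pt v)] = p.@[slice_gen v].
  by apply: meval_eq => l; rewrite gen_slice.
have zero (p : {mpoly K[7]}) (P : {mpoly K[5]}) :
    (forall v, P.@[v] = p.@[slice_gen v]) -> P = 0 -> (fun x : X => p.@[gen^~ x]) = 0.
  move=> eP P0; apply/funext => x; apply: gens_slice_inj => v.
  by rewrite -eP P0 meval0.
split.
- apply/eqP => /(congr1 (fun f : X -> K => f (slice_pt (fun=> 0)))) /eqP.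
  by rewrite oner_eq0.
- move=> _ _ /section_ringP[p ->] /section_ringP[q ->] pq.
  have [P eP] := slice_gen_mpoly p; have [Q eQ] := slice_gen_mpoly q.
  have : P * Q == 0.
    apply/eqP/mpoly_eq0_fun => v; rewrite mevalM eP eQ -!at_slice.
    exact: (congr1 (fun f : X -> K => f (slice_pt v)) pq).
  rewrite mulf_eq0 => /orP[/eqP|/eqP]; [left|right]; exact: zero.
- move=> _ _ /section_ringP[p ->] /section_ringP[q ->] qn0 n c hc e.
  have [P eP] := slice_gen_mpoly p; have [Q eQ] := slice_gen_mpoly q.
  have Qn0 : Q != 0 by apply: contraNneq qn0 => /(zero _ _ eQ) ->.
  have [d hd] := choice (fun i => (section_ringP (c i)).1 (hc i)).
  have [D eD] := choice (fun i => slice_gen_mpoly (d i)).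
  have [|R ePR] := @mpoly_normal _ _ P Q n D Qn0.
    apply: mpoly_eq0_fun => v.
    have := congr1 (fun f : X -> K => f (slice_pt v)) e.
    rewrite !fctE fct_sumE => ev; apply: etrans ev.
    rewrite mevalD rmorphXn /= eP at_slice raddf_sum /=; congr (_ + _).
    apply: eq_bigr => i _; rewrite !mevalM !rmorphXn /= eP eQ eD !fctE.
    by rewrite (hd i) !at_slice.
  have [r er] := slice_quotient_gens eP eQ Qn0 ePR.
  exists (fun x => r.@[gen^~ x]); first by apply/section_ringP; exists r.
  apply/funext => x; rewrite !fctE -mevalM; apply: gens_slice_eq => v.
  by rewrite mevalM -eP -er -eQ ePR mevalM.
Qed.

Lemma section_ring_generated : generated_in_degree_one (fun m => H m).
Proof.
move=> F /section_ringP[p ->]; exists 7%N, gen, p; split=> // l.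
have hX : ('X_l : {mpoly K[7]}) \is 1.-homog by rewrite dhomogX /= mdeg1.
have := gens_section hX; congr (H 1 _).
by apply/funext => x; rewrite mevalXU.
Qed.

End TorusQuotient.

Theorem theorem4p1 (R : realType) :
  projectively_normal (@quotient_section (complex R) 3 7 w37 7).
Proof.
split; [exact: normal_section_ring | exact: section_ring_generated].
Qed.
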